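(* Let $A$ be a finite or countable alphabet, let $\theta$ be a literal (anti)morphism onto $A^*$, and let $\mathcal{F}$ be one of the following families of codes: prefix codes, bifix codes, f.d.d. codes, two-way f.d.d. codes, uniformly synchronized codes, circular codes. Let $X\subseteq A^*$ be a thin $\theta$-invariant code belonging to $\mathcal{F}$. Then the following are equivalent: (i) $X$ is complete; (ii) $X$ is a maximal code; (iii) $X$ is maximal in the family $\mathcal{F}$; (iv) $X$ is maximal in the family of $\theta$-invariant codes; (v) $X$ is maximal in the family of $\theta$-invariant codes belonging to $\mathcal{F}$.
   Context: $A^*$ is the free monoid over $A$, $\varepsilon$ the empty word, $A^+=A^*\setminus\{\varepsilon\}$. Standing assumption: $\theta:A^*\to A^*$ is a bijection, literal ($\theta(A)\subseteq A$), and either a morphism or an antimorphism ($\theta(\varepsilon)=\varepsilon$, $\theta(xy)=\theta(y)\theta(x)$). $X$ is $\theta$-invariant if $\theta(X)=X$. A code is a set $X$ such that any equation $x_1\cdots x_m=y_1\cdots y_n$ with $x_i,y_j\in X$ forces $m=n$ and $x_i=y_i$. $F(S)$ is the set of factors of words in $S$; $X$ is thin if $F(X)\ne A^*$ and complete if $F(X^* )=A^*$. A code is maximal in a family if it is not strictly contained in another code of that family. For sets $S,T$: $S^{-1}T=\{w\mid \exists s\in S,\ sw\in T\}$ and $TS^{-1}=\{w\mid\exists s\in S,\ ws\in T\}$. $X$ is a prefix (suffix) code if $X\ne\{\varepsilon\}$ and $X\cap XA^+=\emptyset$ ($X\cap A^+X=\emptyset$); bifix if both. $X$ is an f.d.d.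 code (finite deciphering delay) if it is a code and there is an integer $d\ge0$ with $X^{-1}X^*\cap X^dA^+\subseteq X^+$; it is a two-way f.d.d. code if moreover there is $d'\ge0$ with $X^*X^{-1}\cap A^+X^{d'}\subseteq X^+$. $X$ is uniformly synchronized if it is a code and there is a positive integer $k$ such that for all $x,y\in X^k$ and $u,v\in A^+$, $uxyv\in X^*$ implies $ux\in X^*$ and $yv\in X^*$. $X$ is circular if for all $x_1,\dots,x_m,y_1,\dots,y_n\in X$ and words $p,s$ with $s\ne\varepsilon$, the equality $x_1\cdots x_m=sy_2\cdots y_np$ with $y_1=ps$ implies $m=n$, $p=\varepsilon$ and $x_i=y_i$ for all $i$. *)

(* Defs.v *)
From mathcomp Require Import all_boot.
From mathcomp Require Import boolp classical_sets.

Set Implicit Arguments.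
Unset Strict Implicit.
Unset Printing Implicit Defensive.

Local Open Scope classical_set_scope.

Section Languages.
Variable A : countType.
Notation word := (seq A).
Implicit Types (X Y S T : set word) (F : set (set word)) (theta : word -> word).

Definition nonempty_words : set word := [set w | w <> [::]].

Definition lang_cat S T : set word := [set s ++ t | s in S & t in T].

(* An element of [X^n] is a concatenation of [n] words of [X]; a list [xs]
   records the sequence of factors x_1, ..., x_n. *)
Definition lang_pow X (n : nat) : set word :=
  [set w | exists xs : seq word,
     [/\ size xs = n, [set` xs] `<=` X & w = flatten xs]].

Definition lang_star X : set word := \bigcup_n lang_pow X n.

Definition lang_plus X : set word :=
  \bigcup_(n in [set n | (0 < n)%N]) lang_pow X n.

(* S^{-1} T *)
Definition lquotient S T : set word := [set w | exists2 s, S s & T (s ++ w)].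

(* T S^{-1} *)
Definition rquotient T S : set word := [set w | exists2 s, S s & T (w ++ s)].

Definition factors S : set word := [set w | exists2 x, S x & infix w x].

Definition thin X : Prop := factors X <> setT.

Definition complete X : Prop := factors (lang_star X) = setT.

Definition code : set (set word) := [set X |
  forall xs ys : seq word, [set` xs] `<=` X -> [set` ys] `<=` X ->
    flatten xs = flatten ys -> xs = ys].

Definition prefix_code : set (set word) := [set X |
  X <> [set [::]] /\ X `&` lang_cat X nonempty_words = set0].

Definition suffix_code : set (set word) := [set X |
  X <> [set [::]] /\ X `&` lang_cat nonempty_words X = set0].

Definition bifix_code : set (set word) := prefix_code `&` suffix_code.

Definition fdd_code : set (set word) := [set X |
  code X /\
  exists d : nat,
    lquotient X (lang_star X) `&` lang_cat (lang_pow X d) nonempty_words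
      `<=` lang_plus X].

Definition two_way_fdd_code : set (set word) := [set X |
  fdd_code X /\
  exists d : nat,
    rquotient (lang_star X) X `&` lang_cat nonempty_words (lang_pow X d)
      `<=` lang_plus X].

Definition uniformly_synchronized_code : set (set word) := [set X |
  code X /\
  exists2 k : nat, (0 < k)%N &
    forall x y u v : word, lang_pow X k x -> lang_pow X k y ->
      u <> [::] -> v <> [::] -> lang_star X (u ++ x ++ y ++ v) ->
      lang_star X (u ++ x) /\ lang_star X (y ++ v)].

(* The language {epsilon} satisfies the circularity condition vacuously,
   hence the explicit conjunct [code X]. *)
Definition circular_code : set (set word) := [set X |
  code X /\
  forall (xs : seq word) (y1 : word) (ys : seq word) (p s : word),
    [set` xs] `<=` X -> [set` y1 :: ys] `<=` X -> s <> [::] ->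
    y1 = p ++ s -> flatten xs = s ++ flatten ys ++ p ->
    p = [::] /\ xs = y1 :: ys].

Definition maximal_in F X : Prop := F X /\ forall Y, F Y -> ~ X `<` Y.

Definition literal theta : Prop :=
  forall a : A, exists b : A, theta [:: a] = [:: b].

Definition word_morphism theta : Prop :=
  theta [::] = [::] /\ forall x y, theta (x ++ y) = theta x ++ theta y.

Definition word_antimorphism theta : Prop :=
  theta [::] = [::] /\ forall x y, theta (x ++ y) = theta y ++ theta x.

Definition invariant_under theta : set (set word) :=
  [set X | theta @` X = X].

End Languages.

Arguments code {A}.
Arguments prefix_code {A}.
Arguments suffix_code {A}.
Arguments bifix_code {A}.
Arguments fdd_code {A}.
Arguments two_way_fdd_code {A}.
Arguments uniformly_synchronized_code {A}.
Arguments circular_code {A}.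

Inductive code_family : Type :=
  | PrefixCodes
  | BifixCodes
  | FddCodes
  | TwoWayFddCodes
  | UniformlySynchronizedCodes
  | CircularCodes.

Definition family_codes {A : countType} (f : code_family) :
    set (set (seq A)) :=
  match f with
  | PrefixCodes => prefix_code
  | BifixCodes => bifix_code
  | FddCodes => fdd_code
  | TwoWayFddCodes => two_way_fdd_code
  | UniformlySynchronizedCodes => uniformly_synchronized_code
  | CircularCodes => circular_code
  end.

(* Main.v *)
(* If X is thin and complete, take w outside F(X): every word u can be completed
   to a word of X* by adding a suffix of w on its left and a prefix of w on its
   right, so that adjoining a new word y to X produces, for large n, more
   factorizations through y than there are words of the corresponding length.

   If X is not complete, it can be extended inside the family while preserving
   theta-invariance. For prefix and bifix codes one adds all the words of some
   fixed length that are incomparable with X. In the other families one adds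
   the words a^(n+1) w b^(n+1) with w of length n not a factor of X*, a different
   from the first letter of w and b from the last one: such words do not overlap
   each other, and they can only occur in a word over the extended code as one
   of its factors, which localizes every condition to X. The extended set is
   theta-invariant since its description is symmetric under renaming letters
   and under reversal. *)

Require Import Defs.
From mathcomp Require Import all_boot zify.
From mathcomp Require Import boolp classical_sets.

Set Implicit Arguments.
Unset Strict Implicit.
Unset Printing Implicit Defensive.

Local Open Scope classical_set_scope.

(** Levi's lemma for the case where [u] is the shorter left part. Every comparison of two
    factorizations of a word below goes through it. *)
Lemma cat_eq_split (T : Type) (u v p q : seq T) :
  u ++ v = p ++ q -> size u <= size p -> exists2 t, p = u ++ t & v = t ++ q.
Proof.
move=> e le; exists (drop (size u) p).
  have := congr1 (take (size u)) e.
  by rewrite take_size_cat // takel_cat // => {1}->; rewrite cat_take_drop.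
have := congr1 (drop (size u)) e.
rewrite drop_size_cat // drop_cat => ->.
case: ltnP => // ge; have -> : size u = size p by apply/eqP; rewrite eqn_leq le.
by rewrite subnn drop0 drop_size.
Qed.

(** * Products and factors of words of a language *)

Section Words.
Variable A : countType.
Notation word := (seq A).
Implicit Types (X Y Z S : set word) (u v w x y z p q : word) (xs ys zs : seq word).

Lemma sub_nil X : [set` [::]] `<=` X.
Proof. by []. Qed.

Lemma sub_cons X x xs : [set` x :: xs] `<=` X <-> X x /\ [set` xs] `<=` X.
Proof.
split=> [h|[hx h] y]; last by rewrite /= in_cons => /orP[/eqP->|/h].
split=> [|y yxs]; first by apply: h; rewrite /= mem_head.
by apply: h; rewrite /= in_cons; apply/orP; right.
Qed.

Lemma sub_cat X xs ys :
  [set` xs ++ ys] `<=` X <-> [set` xs] `<=` X /\ [set` ys] `<=` X.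
Proof.
elim: xs => [|x xs IH]; first by split=> [h|[]].
by rewrite cat_cons !sub_cons IH; tauto.
Qed.

Lemma sub_nseq X x n : X x -> [set` nseq n x] `<=` X.
Proof. by move=> Xx; elim: n => // n IH; apply/sub_cons. Qed.

Lemma starP X w :
  lang_star X w <-> exists2 xs, [set` xs] `<=` X & w = flatten xs.
Proof.
split=> [[n _ [xs [_ h ->]]]|[xs h ->]]; first by exists xs.
by exists (size xs) => //; exists xs.
Qed.

Lemma flatten_star X xs : [set` xs] `<=` X -> lang_star X (flatten xs).
Proof. by move=> h; apply/starP; exists xs. Qed.

Lemma star_cat X u v : lang_star X u -> lang_star X v -> lang_star X (u ++ v).
Proof.
move=> /starP[xs hx ->] /starP[ys hy ->]; rewrite -flatten_cat.
by apply: flatten_star; apply/sub_cat.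
Qed.

Lemma star_sub X Y w : X `<=` Y -> lang_star X w -> lang_star Y w.
Proof.
by move=> XY /starP[xs h ->]; apply: flatten_star; apply: subset_trans h XY.
Qed.

Lemma star1 X x : X x -> lang_star X x.
Proof.
move=> Xx; apply/starP; exists [:: x]; last by rewrite /= cats0.
by apply/sub_cons; split=> //; apply: sub_nil.
Qed.

Lemma plusP X w : w <> [::] -> lang_plus X w <-> lang_star X w.
Proof.
move=> w0; split=> [[n _ h]|[n _ h]]; exists n => //=.
case: n h => // -[xs [/size0nil-> _ e]]; case: w0; exact: e.
Qed.

Lemma factorsP S w : factors S w <-> exists u v, S (u ++ w ++ v).
Proof.
split=> [[x Sx /infixP[u [v e]]]|[u [v h]]]; first by exists u, v; rewrite -e.
by exists (u ++ w ++ v) => //; apply/infixP; exists u, v.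
Qed.

Lemma factors_sub S u w v : factors S (u ++ w ++ v) -> factors S w.
Proof.
move=> /factorsP[p [q h]]; apply/factorsP; exists (p ++ u), (v ++ q).
by move: h; rewrite -!catA.
Qed.

Lemma self_factors S w : S w -> factors S w.
Proof. by move=> Sw; apply/factorsP; exists [::], [::]; rewrite cats0. Qed.

Lemma code_nonempty X : code X -> ~ X [::].
Proof.
move=> cX X0; suff : [::] = [:: [::]] :> seq word by [].
by apply: cX => //; apply/sub_cons.
Qed.

Lemma size_flatten_ge X xs :
  ~ X [::] -> [set` xs] `<=` X -> size xs <= size (flatten xs).
Proof.
move=> X0; elim: xs => //= x xs IH /sub_cons[Xx /IH le].
by rewrite size_cat; case: x Xx => [/X0//|a x _] /=; lia.
Qed.

Lemma first_marker X Z ys : [set` ys] `<=` X `|` Z ->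
  [set` ys] `<=` X \/ exists ys1 z ys2,
    [/\ ys = ys1 ++ z :: ys2, [set` ys1] `<=` X & Z z].
Proof.
elim: ys => [_|y ys IH /sub_cons[Yy /IH h]]; first by left; apply: sub_nil.
case: (pselect (X y)) => Xy; last first.
  by right; exists [::], y, ys; split=> //; case: Yy.
case: h => [h|[ys1 [z [ys2 [-> h Zz]]]]]; first by left; apply/sub_cons.
by right; exists (y :: ys1), z, ys2; split=> //; apply/sub_cons.
Qed.

(** * Thin complete codes are maximal *)

(** Since [w] does not fit inside one word of [X], some boundary between factors of [xs] falls
    within [w] or at one of its ends. *)
Lemma cut_at_unavoidable X xs u w v : ~ factors X w -> [set` xs] `<=` X ->
  flatten xs = u ++ w ++ v ->
  exists xs1 xs2 w1 w2, [/\ xs = xs1 ++ xs2, w = w1 ++ w2,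
    flatten xs1 = u ++ w1 & flatten xs2 = w2 ++ v].
Proof.
move=> Fw; elim: xs u => [|x xs IH] u.
  move=> _ /esym/eqP; rewrite -!size_eq0 !size_cat !addn_eq0 !size_eq0.
  by move=> /and3P[/eqP-> /eqP-> /eqP->]; exists [::], [::], [::], [::].
move=> /sub_cons[Xx hxs] /= e.
case: (leqP (size x) (size u)) => lxu.
  have [t ut et] := cat_eq_split e lxu.
  have [xs1 [xs2 [w1 [w2 [-> -> e1 e2]]]]] := IH t hxs et.
  by exists (x :: xs1), xs2, w1, w2; split=> //=; rewrite e1 ut catA.
have [t xt et] := cat_eq_split (esym e) (ltnW lxu).
case: (leqP (size t) (size w)) => ltw.
  have [t' wt et'] := cat_eq_split (esym et) ltw.
  by exists [:: x], xs, t, t'; split=> //=; rewrite cats0.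
case: Fw; have [t' tw _] := cat_eq_split et (ltnW ltw).
by apply/factorsP; exists u, t'; rewrite -tw -xt.
Qed.

(** Completeness is applied to [w ++ u ++ w]: a boundary falls in each copy of [w], and the factors
    between these two boundaries spell a suffix of [w], then [u], then a prefix of [w]. *)
Lemma complete_absorb X w u : complete X -> ~ factors X w ->
  exists i j, [/\ i <= size w, j <= size w &
    lang_star X (drop i w ++ u ++ take j w)].
Proof.
move=> cX Fw.
have /factorsP[p [q /starP[xs hxs e]]] : factors (lang_star X) (w ++ u ++ w).
  by rewrite cX.
have {}e : flatten xs = p ++ w ++ (u ++ w ++ q) by rewrite -e -!catA.
have [xs1 [xs2 [w1 [w2 [exs ew e1 e2]]]]] := cut_at_unavoidable Fw hxs e.
have [_ h2] : [set` xs1] `<=` X /\ [set` xs2] `<=` X.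
  by apply/sub_cat; rewrite -exs.
have {}e2 : flatten xs2 = (w2 ++ u) ++ w ++ q by rewrite e2 catA.
have [xs3 [xs4 [w3 [w4 [exs2 ew' e3 _]]]]] := cut_at_unavoidable Fw h2 e2.
exists (size w1), (size w3); split.
- by rewrite ew size_cat leq_addr.
- by rewrite ew' size_cat leq_addr.
rewrite {1}ew ew' drop_size_cat // take_size_cat // catA -e3.
by apply: flatten_star; move: h2; rewrite exs2 => /sub_cat[].
Qed.

(** The two sides have the same factorization over [X] and [y], and [y], not being in [X], appears
    exactly once in it. *)
Lemma code_split_unique X y u v u' v' : ~ X y -> code (X `|` [set y]) ->
  lang_star X u -> lang_star X v -> lang_star X u' -> lang_star X v' ->
  u ++ y ++ v = u' ++ y ++ v' -> u = u' /\ v = v'.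
Proof.
move=> Xy cY /starP[xs hx ->] /starP[ys hy ->] /starP[xs' hx' ->].
move=> /starP[ys' hy' ->] e.
have toY zs : [set` zs] `<=` X -> [set` zs] `<=` X `|` [set y].
  by move=> h t /h ?; left.
have /cY : [set` xs ++ y :: ys] `<=` X `|` [set y].
  by apply/sub_cat; split; [exact: toY|apply/sub_cons; split; [right|exact: toY]].
move=> /(_ (xs' ++ y :: ys')) {}cY.
have {cY e} : xs ++ y :: ys = xs' ++ y :: ys'.
  apply: cY; last by rewrite !flatten_cat /=.
  by apply/sub_cat; split; [exact: toY|apply/sub_cons; split; [right|exact: toY]].
elim: xs xs' hx hx' => [|x xs IH] [|x' xs'] //=.
- by move=> _ _ [->].
- by move=> _ /sub_cons[Xx _] [] ex; case: Xy; rewrite ex.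
- by move=> /sub_cons[Xx _] _ [] ex; case: Xy; rewrite -ex.
move=> /sub_cons[_ hx] /sub_cons[_ hx'] [-> /(IH _ hx hx')[e1 ->]].
by rewrite e1.
Qed.

(** The counting argument needs a finite alphabet, while [A] may be infinite; words are therefore
    read over the finitely many letters of [s]. *)
Lemma restrict_alphabet (s : seq A) w : {subset w <= s} ->
  exists wB : seq (seq_sub s), map val wB = w.
Proof.
elim: w => [|a w IH] h; first by exists [::].
have [|wB <-] := IH; first by move=> b bw; apply: h; rewrite in_cons bw orbT.
have ha : a \in s by apply: h; rewrite mem_head.
by exists (SeqSub ha :: wB).
Qed.

(* Cutting a word of length n in one of its n+1 positions into u1 u2 and
   completing both pieces in X*, the words (s1 u1 p1) y (s2 u2 p2) determine
   u1 and u2 up to a number of choices independent of n. *)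
Lemma complete_absorb_maximal (B : finType) (j : B -> A) (w y : seq B) X :
  injective j -> y <> [::] -> ~ X (map j y) -> code (X `|` [set map j y]) ->
  (forall u : seq B, exists i k, [/\ i <= size w, k <= size w &
     lang_star X (map j (drop i w ++ u ++ take k w))]) -> False.
Proof.
move=> jI y0 Xy cY absorb; set l := size w.
have b0 : B by case: y y0 {Xy cY}.
have /choice[f fP] : forall u : seq B, exists ik : 'I_l.+1 * 'I_l.+1,
    lang_star X (map j (drop ik.1 w ++ u ++ take ik.2 w)).
  move=> u; have [i [k [hi hk h]]] := absorb u.
  by exists (inord i, inord k); rewrite /= !inordK // ltnS.
pose c (u : seq B) := drop (f u).1 w ++ u ++ take (f u).2 w.
(* Each of the two completed pieces gains at most [2 * l] letters, so [T] bounds the excess of [W t]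
   over [N]. *)
pose T := (l + l + size y + (l + l))%N.
(* [N] counts the possible cut data of both pieces times the words of length [T]; the [N + 1]
   cutting positions of each word of length [N] then exceed what the target of [g] can hold. *)
pose N := (l.+1 * l.+1 * (l.+1 * l.+1) * #|B| ^ T)%N.
pose u1 (t : 'I_N.+1 * N.-tuple B) := take t.1 t.2.
pose u2 (t : 'I_N.+1 * N.-tuple B) := drop t.1 t.2.
pose W t := c (u1 t) ++ y ++ c (u2 t).
have size_c (u : seq B) : size (c u) = (l - (f u).1 + size u + (f u).2)%N.
  rewrite /c !size_cat size_drop size_take -/l.
  by case: ltnP; have := ltn_ord (f u).2; lia.
have size_u t : (size (u1 t) + size (u2 t) = N)%N.
  by rewrite -size_cat cat_take_drop size_tuple.
have size_WE t : size (W t) = (size (c (u1 t)) + (size y + size (c (u2 t))))%N.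
  by rewrite /W size_cat [size (y ++ _)]size_cat.
have size_W t : size (W t) <= N + T.
  have := size_u t; rewrite size_WE !size_c /T.
  by have := ltn_ord (f (u1 t)).2; have := ltn_ord (f (u2 t)).2; lia.
(* The length of [W t] varies; padding places all these words in one finite type. *)
pose pad t := W t ++ nseq (N + T - size (W t)) b0.
have padP t : size (pad t) == (N + T)%N.
  by apply/eqP; rewrite /pad size_cat size_nseq subnKC.
pose g t : 'I_l.+1 * 'I_l.+1 * ('I_l.+1 * 'I_l.+1) * (N + T).-tuple B :=
  (f (u1 t), f (u2 t), Tuple (padP t)).
have gI : injective g.
  move=> s t [e1 e2 e].
  have eW : W s = W t.
    (* The cut data recorded by [g] determine the length of [W], so the padding can be removed. *)
    have eS : size (W s) = size (W t).
      have := size_u s; have := size_u t.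
      by rewrite !size_WE !size_c e1 e2; lia.
    have := congr1 (take (size (W s))) e.
    by rewrite /pad take_size_cat // eS take_size_cat.
  have [ec1 ec2] : map j (c (u1 s)) = map j (c (u1 t)) /\
                   map j (c (u2 s)) = map j (c (u2 t)).
    apply: (code_split_unique Xy cY); try exact: fP.
    by rewrite -!map_cat -/(W s) -/(W t) eW.
  have unc (u u' : seq B) : f u = f u' -> map j (c u) = map j (c u') -> u = u'.
    move=> ef /(inj_map jI) ec; move: (ec); rewrite /c ef.
    have es : size u = size u'.
      by have := congr1 size ec; rewrite !size_c ef; lia.
    move=> /eqP; rewrite eqseq_cat // eqxx /= eqseq_cat // eqxx andbT.
    by move/eqP.
  have {ec1}E1 := unc _ _ e1 ec1; have {ec2}E2 := unc _ _ e2 ec2.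
  have t2 r : tval r.2 = u1 r ++ u2 r by rewrite /u1 /u2 cat_take_drop.
  case: s t E1 E2 t2 {e1 e2 e eW} => [i v] [k v'] /= E1 E2 t2.
  congr pair; apply: val_inj => /=.
    have := congr1 size E1.
    by rewrite /u1 !size_takel // size_tuple -ltnS ltn_ord.
  by have := t2 (i, v); have := t2 (k, v'); rewrite /= E1 E2 => -> ->.
have := leq_card g gI.
rewrite !card_prod !card_ord !card_tuple expnD (mulnC (#|B| ^ N)) mulnA -/N.
have B_gt0 : 0 < #|B| by apply/card_gt0P; exists b0.
by rewrite leq_pmul2r ?expn_gt0 ?B_gt0 // ltnn.
Qed.

Lemma not_setT_ex S : S <> setT -> exists w, ~ S w.
Proof.
move=> h; apply: contrapT => /forallNP nS; apply: h.
by apply/seteqP; split=> // w _; apply: contrapT; apply: nS.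
Qed.

Lemma code_sub X Y : X `<=` Y -> code Y -> code X.
Proof.
move=> XY cY xs ys hx hy; apply: cY.
  exact: subset_trans hx XY.
exact: subset_trans hy XY.
Qed.

(** A word [y] of a larger code outside [X] would make [X] with [y] a code, which the counting
    argument refutes over the letters of [w] and [y] alone. *)
Lemma complete_maximal X : thin X -> code X -> complete X -> maximal_in code X.
Proof.
move=> /not_setT_ex[w Fw] cX compl; split=> // Y cY [XY /nonsubset[y [Yy Xy]]].
have [sw sy] : {subset w <= w ++ y} /\ {subset y <= w ++ y}.
  by split=> a h; rewrite mem_cat h ?orbT.
have [wB ew] := restrict_alphabet sw.
have [yB ey] := restrict_alphabet sy.
apply: (@complete_absorb_maximal _ val wB yB X val_inj).
- by move=> y0; apply: (code_nonempty cY); move: ey; rewrite y0 /= => ->.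
- by rewrite ey.
- rewrite ey; apply: code_sub cY => x [/XY//|->//].
move=> u; have [i [k [hi hk h]]] := complete_absorb (map val u) compl Fw.
exists i, k; rewrite -[size wB](size_map val) ew; split=> //.
by rewrite !map_cat map_drop map_take ew.
Qed.

(** * Extending an incomplete code by markers *)

(* Last condition: a word of Z occurring in a product of words of X and Z is one
   of the factors of that product. *)
Record markers X Z (L : nat) : Prop := Markers {
  markers_gt0 : 0 < L;
  markers_size : forall z, Z z -> size z = L;
  markers_incompletable : forall z, Z z -> ~ factors (lang_star X) z;
  markers_sync : forall ys u z v, [set` ys] `<=` X `|` Z -> Z z ->
    flatten ys = u ++ z ++ v ->
    exists ys1 ys2, ys = ys1 ++ z :: ys2 /\ flatten ys1 = u }.

Lemma markers_star X Z L u z v : markers X Z L -> Z z ->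
  lang_star (X `|` Z) (u ++ z ++ v) ->
  lang_star (X `|` Z) u /\ lang_star (X `|` Z) v.
Proof.
move=> mZ Zz /starP[ys hys e].
have [ys1 [ys2 [eys eu]]] := markers_sync mZ hys Zz (esym e).
move: hys; rewrite eys => /sub_cat[h1 /sub_cons[_ h2]].
have -> : v = flatten ys2.
  move/eqP: e; rewrite eys flatten_cat eu /= eqseq_cat // eqxx /=.
  by rewrite eqseq_cat // eqxx /= => /eqP.
by rewrite -eu; split; apply: flatten_star.
Qed.

Lemma markers_notin X Z L z : markers X Z L -> Z z -> ~ X z.
Proof.
move=> mZ Zz Xz; apply: (markers_incompletable mZ Zz).
by apply: self_factors; apply: star1.
Qed.

Lemma star_unionl X Z w : lang_star X w -> lang_star (X `|` Z) w.
Proof. by apply: star_sub; exact: subsetUl. Qed.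

(** By induction on the number of factors: a marker used in one factorization is a factor of the
    other at the same position, so both are cut there. Without markers, [X] being a code
    suffices. *)
Lemma markers_code X Z L : markers X Z L -> code X -> code (X `|` Z).
Proof.
move=> mZ cX xs ys; have [n] := ubnP (size xs + size ys).
elim: n xs ys => // n IH xs ys hn hx hy e.
have split_z xs1 z xs2 ys1 ys2 : (size (xs1 ++ z :: xs2) + size (ys1 ++ z :: ys2) < n.+1)%N ->
  [set` xs1 ++ z :: xs2] `<=` X `|` Z -> [set` ys1 ++ z :: ys2] `<=` X `|` Z ->
  flatten ys1 = flatten xs1 ->
  flatten (xs1 ++ z :: xs2) = flatten (ys1 ++ z :: ys2) ->
  xs1 ++ z :: xs2 = ys1 ++ z :: ys2.
  rewrite !size_cat /= => hs /sub_cat[h1 /sub_cons[_ h2]] /sub_cat[h3 /sub_cons[_ h4]] e1.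
  rewrite !flatten_cat e1 => /eqP; rewrite eqseq_cat // eqxx /= eqseq_cat // eqxx /= => /eqP e2.
  by congr (_ ++ _ :: _); apply: IH; rewrite ?e1 //; lia.
have [hxX|[xs1 [z [xs2 [ex _ Zz]]]]] := first_marker hx; last first.
  have [ys1 [ys2 [ey e1]]] : exists ys1 ys2, ys = ys1 ++ z :: ys2 /\ flatten ys1 = flatten xs1.
    by apply: (markers_sync (v := flatten xs2) mZ) => //; rewrite -e ex flatten_cat.
  by rewrite ex ey; apply: split_z; rewrite -?ex -?ey.
have [hyX|[ys1 [z [ys2 [ey _ Zz]]]]] := first_marker hy; first exact: cX.
have [xs1 [xs2 [ex e1]]] : exists xs1 xs2, xs = xs1 ++ z :: xs2 /\ flatten xs1 = flatten ys1.
  by apply: (markers_sync (v := flatten ys2) mZ) => //; rewrite e ey flatten_cat.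
by rewrite ex ey; apply: split_z; rewrite -?ex -?ey.
Qed.

(** The first marker cannot lie inside the completable prefix [q], so it ends beyond [q]; the words
    of [X] before it miss fewer than [L] letters of [q]. *)
Lemma prefix_factorization X Z L ys q v : markers X Z L ->
  [set` ys] `<=` X `|` Z -> flatten ys = q ++ v -> factors (lang_star X) q ->
  exists h f, [/\ ys = h ++ f, [set` h] `<=` X & size q < size (flatten h) + L].
Proof.
move=> mZ hys e Fq; have L0 := markers_gt0 mZ.
have [hX|[h [z [f [ey hh Zz]]]]] := first_marker hys.
  exists ys, [::]; rewrite cats0 e size_cat; split=> //; lia.
exists h, (z :: f); split=> //; rewrite ltnNge; apply/negP => le.
apply: (markers_incompletable mZ Zz).
have {}e : (flatten h ++ z) ++ flatten f = q ++ v.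
  by rewrite -e ey flatten_cat /= catA.
have [|t qt _] := cat_eq_split e; first by rewrite size_cat (markers_size mZ Zz).
by apply: (@factors_sub _ (flatten h) _ t); rewrite catA -qt.
Qed.

(* A marker cannot lie inside the completable factor q, so those meeting q only
   overlap it at the ends. *)
Lemma inner_factorization X Z L ys u q v : markers X Z L ->
  [set` ys] `<=` X `|` Z -> flatten ys = u ++ q ++ v -> factors (lang_star X) q ->
  exists g h f, [/\ ys = g ++ h ++ f, [set` h] `<=` X,
    size (flatten g) <= size u + L & size (u ++ q) < size (flatten (g ++ h)) + L].
Proof.
move=> mZ; have L0 := markers_gt0 mZ.
elim: ys u => [|y ys IH] u.
  move=> _ /= /esym/(congr1 size); rewrite !size_cat /= => e _.
  exists [::], [::], [::]; split; rewrite ?size_cat //=; lia.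
move=> /sub_cons[Yy hys] /= e Fq.
case: (leqP (size y) (size u)) => lyu.
  have [t ut et] := cat_eq_split e lyu.
  have [g [h [f [-> hh lg lgh]]]] := IH t hys et Fq.
  exists (y :: g), h, f; split=> //=; rewrite ?ut /= !size_cat in lg lgh *; lia.
case: (leqP (size (u ++ q)) (size y)) => lyq.
  case: Yy => [Xy|Zy].
    exists [::], [:: y], ys; split=> //=; last by rewrite cats0; lia.
    by apply/sub_cons; split=> //; apply: sub_nil.
  exists [:: y], [::], ys; split=> //=; rewrite cats0 ?(markers_size mZ Zy) //; try lia.
  by rewrite -(markers_size mZ Zy); lia.
have [q1 yq et] := cat_eq_split (esym e) (ltnW lyu).
have [|q2 qq et'] := cat_eq_split (esym et).
  by move: lyq; rewrite yq !size_cat; lia.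
have Fq2 : factors (lang_star X) q2.
  by apply: (@factors_sub _ q1 _ [::]); rewrite cats0 -qq.
have [h [f [eys hh lh]]] := prefix_factorization mZ hys et' Fq2.
case: Yy => [Xy|Zy].
  exists [::], (y :: h), f; split=> //=; first by rewrite eys.
    by apply/sub_cons.
  by rewrite yq qq !size_cat; lia.
exists [:: y], h, f; split=> //=; first by rewrite eys.
  by rewrite cats0 (markers_size mZ Zy) leq_addl.
by rewrite yq qq !size_cat; lia.
Qed.

(** * Reversal *)

Lemma rev_neq0 v : v <> [::] -> rev v <> [::].
Proof. by case/lastP: v => // v a _; rewrite rev_rcons. Qed.

(** Through mirror images, each right-to-left condition is deduced from its left-to-right
    counterpart. *)
Definition reversal X : set word := [set w | X (rev w)].
Definition rev_list xs : seq word := rev (map rev xs).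

Lemma rev_listK : involutive rev_list.
Proof.
by move=> xs; rewrite /rev_list map_rev revK -map_comp map_id_in // => x _; apply: revK.
Qed.

Lemma flatten_rev_list xs : flatten (rev_list xs) = rev (flatten xs).
Proof. by rewrite rev_flatten. Qed.

Lemma reversalK X : reversal (reversal X) = X.
Proof. by apply/funext => w; rewrite /reversal /mkset revK. Qed.

Lemma reversalU X Z : reversal (X `|` Z) = reversal X `|` reversal Z.
Proof. by []. Qed.

Lemma sub_rev_list X xs : [set` rev_list xs] `<=` X <-> [set` xs] `<=` reversal X.
Proof.
split=> h x /= hx.
  by apply: h; rewrite /rev_list /= mem_rev; apply: map_f.
by move: hx; rewrite mem_rev => /mapP[y hy ->]; apply: h.
Qed.

Lemma pow_reversal X n w : lang_pow (reversal X) n w <-> lang_pow X n (rev w).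
Proof.
have aux Y u : lang_pow (reversal Y) n u -> lang_pow Y n (rev u).
  move=> [xs [<- h ->]]; exists (rev_list xs); rewrite flatten_rev_list; split=> //.
    by rewrite size_rev size_map.
  exact/sub_rev_list.
split; first exact: aux.
by rewrite -{1}(reversalK X) => /aux; rewrite revK.
Qed.

Lemma star_reversal X w : lang_star (reversal X) w <-> lang_star X (rev w).
Proof.
split=> -[n nT h]; exists n => //; first exact: (proj1 (pow_reversal X n w)).
exact: (proj2 (pow_reversal X n w)).
Qed.

Lemma code_reversal X : code X -> code (reversal X).
Proof.
move=> cX xs ys hx hy e; apply: (inv_inj rev_listK); apply: cX.
- exact/sub_rev_list.
- exact/sub_rev_list.
by rewrite !flatten_rev_list e.
Qed.

Lemma markers_reversal X Z L : markers X Z L -> markers (reversal X) (reversal Z) L.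
Proof.
move=> mZ; split; first exact: markers_gt0 mZ.
- by move=> z /(markers_size mZ); rewrite size_rev.
- move=> z /(markers_incompletable mZ) nz /factorsP[u [v /star_reversal h]].
  by apply: nz; apply/factorsP; exists (rev v), (rev u); rewrite -!rev_cat -catA.
move=> ys u z v hys Zz e.
have := @markers_sync _ _ _ mZ (rev_list ys) (rev v) (rev z) (rev u).
move=> [| | |ys1 [ys2 [eys e1]]] //; first exact/sub_rev_list.
  by rewrite flatten_rev_list e !rev_cat catA.
have ey : ys = rev_list ys2 ++ z :: rev_list ys1.
  by rewrite -(rev_listK ys) eys {1}/rev_list map_cat /= rev_cat rev_cons revK cat_rcons.
exists (rev_list ys2), (rev_list ys1); split=> //.
have ev : flatten (rev_list ys1) = v by rewrite flatten_rev_list e1 revK.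
move: e; rewrite ey flatten_cat /= ev => e.
have es : size (flatten (rev_list ys2)) = size u.
  by have := congr1 size e; rewrite !size_cat; lia.
by move/eqP: e; rewrite eqseq_cat // => /andP[/eqP].
Qed.

(** * Deciphering delay, synchronization and circularity *)

(** The deciphering delay condition with quotient and product unfolded; the word [w ++ v] is
    nonempty, so [lang_star] can replace [lang_plus]. *)
Definition bounded_delay X d : Prop := forall s w v, X s -> lang_pow X d w ->
  v <> [::] -> lang_star X (s ++ w ++ v) -> lang_star X (w ++ v).

Lemma bounded_delayP X d : bounded_delay X d <->
  lquotient X (lang_star X) `&` lang_cat (lang_pow X d) (@nonempty_words A)
    `<=` lang_plus X.
Proof.
split=> [dX t [[s Xs hs] [w hw [v v0 e]]]|h s w v Xs hw v0 hs].
  rewrite -e in hs *; apply/plusP; last exact: (dX s).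
  by move=> /eqP; rewrite -size_eq0 size_cat addn_eq0 !size_eq0 => /andP[_ /eqP].
apply/plusP; last first.
  by apply: h; split; [exists s|exists w => //; exists v].
by move=> /eqP; rewrite -size_eq0 size_cat addn_eq0 !size_eq0 => /andP[_ /eqP].
Qed.

Lemma right_bounded_delayP X d : bounded_delay (reversal X) d <->
  rquotient (lang_star X) X `&` lang_cat (@nonempty_words A) (lang_pow X d)
    `<=` lang_plus X.
Proof.
split=> [dX t [[s Xs hs] [v v0 [w hw e]]]|h s w v Xs hw v0 hs].
  rewrite -e in hs *; apply/plusP.
    by move=> /eqP; rewrite -size_eq0 size_cat addn_eq0 !size_eq0 => /andP[/eqP].
  rewrite -[v ++ w]revK rev_cat; apply/star_reversal.
  apply: (dX (rev s)); rewrite /reversal /= ?revK //.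
  - by apply/pow_reversal; rewrite revK.
  - exact: rev_neq0.
  - by apply/star_reversal; rewrite !rev_cat !revK.
apply/star_reversal; rewrite rev_cat; apply/plusP.
  move=> /eqP; rewrite -size_eq0 size_cat addn_eq0 !size_eq0 => /andP[/eqP e _].
  exact: (rev_neq0 v0).
apply: h; split; first by exists (rev s) => //; rewrite -!rev_cat; apply/star_reversal.
exists (rev v); first exact: rev_neq0.
by exists (rev w) => //; apply/pow_reversal.
Qed.

Lemma leq_size_flatten X xs n : code X -> [set` xs] `<=` X ->
  n <= size xs -> n <= size (flatten xs).
Proof.
by move=> cX h le; apply: leq_trans le (size_flatten_ge (code_nonempty cX) h).
Qed.

(** A marker among the [xs] is a cut in every factorization: what follows it is a product, and what
    precedes it within [xs] already was one. *)
Lemma flatten_marker X Z L xs v : markers X Z L -> [set` xs] `<=` X `|` Z ->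
  ~ [set` xs] `<=` X -> forall u, lang_star (X `|` Z) (u ++ flatten xs ++ v) ->
  lang_star (X `|` Z) (flatten xs ++ v).
Proof.
move=> mZ hxs nX u h.
have [//|[xs1 [z [xs2 [ex _ Zz]]]]] := first_marker hxs.
have [_ hv] : lang_star (X `|` Z) (u ++ flatten xs1) /\
    lang_star (X `|` Z) (flatten xs2 ++ v).
  by apply: (markers_star mZ Zz); move: h; rewrite ex flatten_cat /= -!catA.
move: hxs; rewrite ex flatten_cat /= -!catA => /sub_cat[h1 /sub_cons[h2 _]].
by apply: star_cat; [exact: flatten_star|apply: star_cat => //; exact: star1].
Qed.

(** The first [d] factors serve the delay of [X]. The [L] others have total length at least [L], so
    a marker straddling the end of the known part starts after those [d] factors. *)
Lemma markers_bounded_delay X Z L d : markers X Z L -> code X ->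
  bounded_delay X d -> bounded_delay (X `|` Z) (d + L).
Proof.
move=> mZ cX dX s w v Ys [xs [sxs hxs ->]] v0 hs.
case: Ys => [Xs|Zs]; last by have [] := markers_star (u := [::]) mZ Zs hs.
case: (pselect ([set` xs] `<=` X)) => hX; last exact: (flatten_marker mZ hxs hX hs).
have /starP[ts hts ets] := hs.
have ex : xs = take d xs ++ drop d xs by rewrite cat_take_drop.
have [hX1 hX2] : [set` take d xs] `<=` X /\ [set` drop d xs] `<=` X.
  by apply/sub_cat; rewrite -ex.
have l2 : L <= size (flatten (drop d xs)).
  by apply: (leq_size_flatten cX) => //; rewrite size_drop sxs; lia.
have Fq : factors (lang_star X) (s ++ flatten xs).
  by apply: self_factors; apply: star_cat; [exact: star1|exact: flatten_star].
have {}ets : flatten ts = (s ++ flatten xs) ++ v by rewrite -ets -catA.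
have [h [f [et hh lh]]] := prefix_factorization mZ hts ets Fq.
move: ets; rewrite et flatten_cat.
have -> : (s ++ flatten xs) ++ v =
    (s ++ flatten (take d xs)) ++ (flatten (drop d xs) ++ v).
  by rewrite {1}ex flatten_cat -!catA.
move=> /esym e.
have lh' : size (s ++ flatten (take d xs)) < size (flatten h).
  by move: lh; rewrite {1}ex flatten_cat !size_cat; lia.
have [v' ev' ev] := cat_eq_split e (ltnW lh').
have -> : flatten xs ++ v = (flatten (take d xs) ++ v') ++ flatten f.
  by rewrite {1}ex flatten_cat -!catA ev.
have hf : [set` f] `<=` X `|` Z by move: hts; rewrite et => /sub_cat[].
apply: star_cat; last exact: flatten_star.
apply: star_unionl; apply: (dX s) => //.
- by exists (take d xs); split=> //; rewrite size_takel // sxs leq_addr.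
- by move=> v'0; move: lh'; rewrite ev' v'0 cats0 ltnn.
- by rewrite catA -ev'; exact: flatten_star.
Qed.

(** One half of uniform synchronization; the other half is the same property of the mirror image. *)
Definition right_synchronized X k : Prop := forall x y u v,
  lang_pow X k x -> lang_pow X k y -> u <> [::] -> v <> [::] ->
  lang_star X (u ++ x ++ y ++ v) -> lang_star X (y ++ v).

Lemma uniformly_synchronizedP X : uniformly_synchronized_code X <->
  code X /\ exists2 k, 0 < k &
    right_synchronized X k /\ right_synchronized (reversal X) k.
Proof.
split=> -[cX [k k0 h]]; split=> //; exists k => //.
  split=> [x y u v Xx Xy u0 v0 /(h _ _ _ _ Xx Xy u0 v0)[]//|].
  move=> x y u v /pow_reversal Xx /pow_reversal Xy u0 v0 /star_reversal.
  rewrite !rev_cat -!catA => /(h _ _ _ _ Xy Xx (rev_neq0 v0) (rev_neq0 u0))[hv _].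
  by apply/star_reversal; rewrite rev_cat.
case: h => h hr x y u v Xx Xy u0 v0 hs; split; last exact: (h x y u v).
rewrite -[u ++ x]revK rev_cat; apply/star_reversal.
apply: (hr (rev y) (rev x) (rev v) (rev u)); try exact: rev_neq0.
- by apply/pow_reversal; rewrite revK.
- by apply/pow_reversal; rewrite revK.
by apply/star_reversal; rewrite !rev_cat !revK -!catA.
Qed.

Lemma flatten_neq0 X xs : code X -> [set` xs] `<=` X -> 0 < size xs -> flatten xs <> [::].
Proof. by move=> cX h s0 e; have := leq_size_flatten cX h s0; rewrite e. Qed.

(* Padding p on the left with copies of a word of X makes it long enough. *)
Lemma right_synchronized_star X k p y v : code X -> 0 < k -> right_synchronized X k ->
  lang_star X p -> lang_pow X k y -> v <> [::] ->
  lang_star X (p ++ y ++ v) -> lang_star X (y ++ v).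
Proof.
move=> cX k0 sX /starP[ps hps ->] hy v0 hs.
have [x0 Xx0] : exists x0, X x0.
  case: hy => -[|x0 ys] [sy h _]; first by move: k0; rewrite -sy.
  by exists x0; case/sub_cons: h.
pose ws := nseq k.+1 x0 ++ ps; pose m := (size ws - k)%N.
have sws : size ws = (k.+1 + size ps)%N by rewrite size_cat size_nseq.
have hws : [set` ws] `<=` X by apply/sub_cat; split=> //; exact: sub_nseq.
have [h1 h2] : [set` take m ws] `<=` X /\ [set` drop m ws] `<=` X.
  by apply/sub_cat; rewrite cat_take_drop.
apply: (sX (flatten (drop m ws)) y (flatten (take m ws))) => //.
- by exists (drop m ws); split=> //; rewrite size_drop /m; lia.
- by apply: (flatten_neq0 cX h1); rewrite size_takel /m; lia.
rewrite catA -flatten_cat cat_take_drop /ws flatten_cat -catA; apply: star_cat => //.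
by apply: flatten_star; exact: sub_nseq.
Qed.

Lemma last_marker X Z ys : [set` ys] `<=` X `|` Z ->
  [set` ys] `<=` X \/ exists ys1 z ys2,
    [/\ ys = ys1 ++ z :: ys2, [set` ys2] `<=` X & Z z].
Proof.
move=> h; case: (first_marker (X := reversal X) (Z := reversal Z) (ys := rev_list ys)).
- by rewrite -reversalU; apply/sub_rev_list; rewrite reversalK.
- by move=> h'; left; move/sub_rev_list: h'; rewrite reversalK.
move=> [ys1 [z [ys2 [e hys Zz]]]]; right; exists (rev_list ys2), (rev z), (rev_list ys1).
split=> //; last exact/sub_rev_list.
by rewrite -(rev_listK ys) e {1}/rev_list map_cat /= rev_cat rev_cons cat_rcons.
Qed.

(** A marker among the given factors gives a cut. Otherwise the [L + 1] outer factors on each side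
    absorb the markers that overlap the ends, and the [k] inner factors on each side serve the
    synchronization of [X]. *)
Lemma markers_right_synchronized X Z L k : markers X Z L -> code X -> 0 < k ->
  right_synchronized X k -> right_synchronized (X `|` Z) (k + L.+1).
Proof.
move=> mZ cX k0 sX _ _ u v [xs [sxs hxs ->]] [ys [sys hys ->]] u0 v0 hs.
case: (pselect ([set` ys] `<=` X)) => hY; last first.
  by apply: (flatten_marker mZ hys hY (u := u ++ flatten xs)); rewrite -catA.
have ey : flatten ys = flatten (take k ys) ++ flatten (drop k ys).
  by rewrite -flatten_cat cat_take_drop.
have [hY1 hY2] : [set` take k ys] `<=` X /\ [set` drop k ys] `<=` X.
  by apply/sub_cat; rewrite cat_take_drop.
have l2 : L < size (flatten (drop k ys)).
  by apply: (leq_size_flatten cX) => //; rewrite size_drop sys; lia.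
have py : lang_pow X k (flatten (take k ys)).
  by exists (take k ys); split=> //; rewrite size_takel // sys leq_addr.
rewrite ey -catA; have [hX|[xs1 [z [xs2 [ex hX Zz]]]]] := last_marker hxs; last first.
  have [_ {}hs] : lang_star (X `|` Z) (u ++ flatten xs1) /\
      lang_star (X `|` Z) ((flatten xs2 ++ flatten ys) ++ v).
    by apply: (markers_star mZ Zz); move: hs; rewrite ex flatten_cat /= -!catA.
  have /starP[ts hts ets] := hs.
  have Fq : factors (lang_star X) (flatten xs2 ++ flatten ys).
    by apply: self_factors; apply: star_cat; exact: flatten_star.
  have [h [f [et hh lh]]] := prefix_factorization mZ hts (esym ets) Fq.
  move: ets; rewrite et flatten_cat ey => e.
  have {}e : (flatten xs2 ++ flatten (take k ys)) ++ (flatten (drop k ys) ++ v) =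
      flatten h ++ flatten f by rewrite -e -!catA.
  have lh' : size (flatten xs2 ++ flatten (take k ys)) < size (flatten h).
    by move: lh; rewrite ey !size_cat; lia.
  have [v' ev' ev] := cat_eq_split e (ltnW lh').
  have hf : [set` f] `<=` X `|` Z by move: hts; rewrite et => /sub_cat[].
  rewrite ev catA; apply: star_cat; last exact: flatten_star.
  apply: star_unionl.
  (* Fewer than [k] factors may follow the last marker, hence the version with an arbitrary product
     on the left. *)
  apply: (right_synchronized_star cX k0 sX (flatten_star hX)) => //.
    by move=> v'0; move: lh'; rewrite ev' v'0 cats0 ltnn.
  by rewrite catA -ev'; exact: flatten_star.
have ex : flatten xs = flatten (take L.+1 xs) ++ flatten (drop L.+1 xs).
  by rewrite -flatten_cat cat_take_drop.
have [hX1 hX2] : [set` take L.+1 xs] `<=` X /\ [set` drop L.+1 xs] `<=` X.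
  by apply/sub_cat; rewrite cat_take_drop.
have l1 : L < size (flatten (take L.+1 xs)).
  by apply: (leq_size_flatten cX) => //; rewrite size_takel // sxs leq_addl.
have /starP[ts hts ets] := hs.
have Fq : factors (lang_star X) (flatten xs ++ flatten ys).
  by apply: self_factors; apply: star_cat; exact: flatten_star.
have {}ets : flatten ts = u ++ (flatten xs ++ flatten ys) ++ v by rewrite -ets -!catA.
have [g [h [f [et hh lg lh]]]] := inner_factorization mZ hts ets Fq.
have e : flatten g ++ (flatten h ++ flatten f) = (u ++ flatten (take L.+1 xs)) ++
    (flatten (drop L.+1 xs) ++ flatten (take k ys)) ++ flatten (drop k ys) ++ v.
  have -> : flatten g ++ flatten h ++ flatten f = flatten ts by rewrite et !flatten_cat.
  by rewrite ets ex ey -!catA.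
(* The left marker may extend [L] letters beyond [u]; one factor more makes the inequality strict
   and the left context [u'] nonempty. *)
have lg' : size (flatten g) < size (u ++ flatten (take L.+1 xs)) by rewrite size_cat; lia.
have [u' eu' eu] := cat_eq_split e (ltnW lg').
have u'0 : u' <> [::] by move=> u'0; move: lg'; rewrite eu' u'0 cats0 ltnn.
have {}e : (u' ++ flatten (drop L.+1 xs) ++ flatten (take k ys)) ++
    flatten (drop k ys) ++ v = flatten h ++ flatten f by rewrite eu -!catA.
have lh' : size (u' ++ flatten (drop L.+1 xs) ++ flatten (take k ys)) < size (flatten h).
  have := congr1 size eu'; move: lh.
  by rewrite flatten_cat ex ey !size_cat; lia.
have [v' ev' ev] := cat_eq_split e (ltnW lh').
have hf : [set` f] `<=` X `|` Z by move: hts; rewrite et => /sub_cat[_ /sub_cat[]].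
rewrite ev catA; apply: star_cat; last exact: flatten_star.
apply: star_unionl.
apply: (sX (flatten (drop L.+1 xs)) _ u') => //.
- by exists (drop L.+1 xs); split=> //; rewrite size_drop sxs addnK.
- by move=> v'0; move: lh'; rewrite ev' v'0 cats0 ltnn.
by move: ev'; rewrite -!catA => <-; exact: flatten_star.
Qed.

(** Schützenberger's stability criterion: the unique factorization of [a ++ w ++ b] is cut both
    before and after [w]. *)
Lemma code_stable X a b w : code X -> lang_star X a -> lang_star X (a ++ w) ->
  lang_star X (w ++ b) -> lang_star X b -> lang_star X w.
Proof.
move=> cX /starP[xa ha ->] /starP[xaw haw eaw] /starP[xwb hwb ewb] /starP[xb hb eb].
have e : xa ++ xwb = xaw ++ xb.
  apply: cX; [by apply/sub_cat|by apply/sub_cat|].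
  by rewrite !flatten_cat -ewb -eaw -eb catA.
case: (leqP (size xa) (size xaw)) => le.
  have [t et _] := cat_eq_split e le.
  move: haw eaw; rewrite et => /sub_cat[_ ht]; rewrite flatten_cat => /eqP.
  by rewrite eqseq_cat // eqxx => /eqP->; exact: flatten_star.
have [t et _] := cat_eq_split (esym e) (ltnW le).
have w0 : w = [::].
  have := congr1 size eaw; rewrite et flatten_cat !size_cat => es.
  by apply: size0nil; lia.
by rewrite w0; apply/starP; exists [::].
Qed.

Lemma cut_factorization ys u v : flatten ys = u ++ v -> v <> [::] ->
  exists ys1 p s ys2, [/\ ys = ys1 ++ (p ++ s) :: ys2, u = flatten ys1 ++ p,
    s <> [::] & v = s ++ flatten ys2].
Proof.
move=> e v0; elim: ys u e => [|y ys IH] u /= e; first by case: u v v0 e => [|? ?] [].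
case: (leqP (size y) (size u)) => lyu.
  have [t ut et] := cat_eq_split e lyu.
  have [ys1 [p [s [ys2 [-> et' s0 ->]]]]] := IH t et.
  by exists (y :: ys1), p, s, ys2; rewrite /= ut et' -catA.
have [t yt et] := cat_eq_split (esym e) (ltnW lyu).
exists [::], u, t, ys; rewrite -yt; split=> // t0.
by move: lyu; rewrite yt t0 cats0 ltnn.
Qed.

(** Circular codes are the codes for which [X*] is very pure. This form speaks of membership in [X*]
    only, which suits cuts at markers. *)
Lemma circularP X : circular_code X <-> code X /\ forall u v,
  lang_star X (u ++ v) -> lang_star X (v ++ u) -> lang_star X u.
Proof.
split=> -[cX h]; split=> //.
  move=> u v /starP[ys hys e] /starP[xs hxs e'].
  case: (pselect (v = [::])) => [v0|v0].
    by rewrite -[u]cats0 -v0 e; exact: flatten_star.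
  have [ys1 [p [t [ys2 [eys eu t0 ev]]]]] := cut_factorization (esym e) v0.
  move: hys; rewrite eys => /sub_cat[h1 /sub_cons[h2 h3]].
  (* The factorization of [u ++ v] is rotated so as to start inside the factor [p ++ t] where [v]
     begins; it then spells [v ++ u]. *)
  have [||p0 _] := h xs (p ++ t) (ys2 ++ ys1) p t hxs _ t0 erefl.
  - by apply/sub_cons; split=> //; apply/sub_cat.
  - by rewrite -e' eu ev flatten_cat -!catA.
  by rewrite eu p0 cats0; exact: flatten_star.
move=> xs y1 ys p s hxs hys s0 ey e.
have [Xy1 hys'] : X y1 /\ [set` ys] `<=` X by apply/sub_cons.
have e1 : lang_star X (p ++ (s ++ flatten ys)).
  by rewrite catA -ey; apply: star_cat; [exact: star1|exact: flatten_star].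
have e2 : lang_star X ((s ++ flatten ys) ++ p) by rewrite -catA -e; exact: flatten_star.
have /starP[ps hps ep] := h _ _ e1 e2.
have /starP[ss hss es] := h _ _ e2 e1.
(* If the product [p] had a factor, unique factorization would make its first one [y1 = p ++ s],
   leaving no letter for [s]. *)
have p0 : p = [::].
  case: ps hps ep => [|q ps] hps ep //.
  have : (q :: ps) ++ ss = y1 :: ys.
    apply: cX => //; first exact/sub_cat.
    by rewrite flatten_cat -ep -es /= ey catA.
  case=> eq _; have := congr1 size ep; rewrite /= eq ey !size_cat => sz.
  by case: s0; apply: size0nil; lia.
split=> //; apply: cX => //.
by rewrite e p0 /= ey p0 cats0.
Qed.

(** A marker in a factorization of [u ++ v] or [v ++ u] provides cuts to which stability applies;
    without any, circularity of [X] concludes. *)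
Lemma markers_circular X Z L : markers X Z L -> circular_code X ->
  circular_code (X `|` Z).
Proof.
move=> mZ /circularP[cX hX]; have cY := markers_code mZ cX.
apply/circularP; split=> //.
have key u v zs1 z zs2 : [set` zs1 ++ z :: zs2] `<=` X `|` Z -> Z z ->
    u ++ v = flatten (zs1 ++ z :: zs2) -> lang_star (X `|` Z) (v ++ u) ->
    lang_star (X `|` Z) u.
  (* The word (vu)(vu) contains uv, hence the marker z. *)
  move=> /sub_cat[h1 /sub_cons[Yz h2]] Zz e hvu.
  have [h3 h4] : lang_star (X `|` Z) (v ++ flatten zs1) /\
      lang_star (X `|` Z) (flatten zs2 ++ u).
    apply: (markers_star mZ Zz).
    have := star_cat hvu hvu; rewrite -catA (catA u v u) e flatten_cat /=.
    by rewrite -!catA.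
  apply: (code_stable cY (flatten_star h2) h4 (b := v ++ flatten zs1)) => //.
  rewrite catA e -flatten_cat; apply: flatten_star.
  by apply/sub_cat; split=> //; apply/sub_cat; split=> //; apply/sub_cons.
move=> u v huv hvu; have /starP[xs hxs exs] := huv; have /starP[ys hys eys] := hvu.
have [xX|[xs1 [z [xs2 [ex _ Zz]]]]] := first_marker hxs; last first.
  by apply: (key u v xs1 z xs2) => //; rewrite -ex.
have [yX|[ys1 [z [ys2 [ey _ Zz]]]]] := first_marker hys; last first.
  have hv : lang_star (X `|` Z) v by apply: (key v u ys1 z ys2) => //; rewrite -ey.
  exact: (code_stable cY hv hvu huv hv).
by apply: star_unionl; apply: (hX u v); rewrite ?exs ?eys; exact: flatten_star.
Qed.

(** * Existence of markers *)

(** The runs are one letter longer than the core, so an initial run that starts inside the core of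
    another such word reaches its last run. The defaults of [head] and [last] exclude an empty
    core. *)
Definition marker_words X n : set word := [set z | exists a b w,
  [/\ size w = n, ~ factors (lang_star X) w, head a w <> a, last b w <> b &
      z = nseq n.+1 a ++ w ++ nseq n.+1 b]].

Lemma size_marker_words X n z : marker_words X n z -> size z = (n.+1 + (n + n.+1))%N.
Proof. by move=> [a [b [w [sw _ _ _ ->]]]]; rewrite !size_cat !size_nseq sw. Qed.

Lemma marker_words_letters X n z (l0 : A) : marker_words X n z -> exists a b,
  [/\ 0 < n, forall i, i < n.+1 -> nth l0 z i = a, nth l0 z n.+1 <> a,
      nth l0 z (n.+1 + n).-1 <> b &
      forall i, n.+1 + n <= i -> i < n.+1 + (n + n.+1) -> nth l0 z i = b].
Proof.
move=> [a [b [w [sw _ ha hb ->]]]]; exists a, b.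
have n0 : 0 < n by rewrite -sw; case: w ha {sw hb}.
split=> //.
- by move=> i lt; rewrite nth_cat size_nseq lt nth_nseq lt.
- rewrite nth_cat size_nseq ltnn subnn nth_cat sw n0 nth0.
  by case: w ha {sw hb}.
- rewrite nth_cat size_nseq ifF; last by lia.
  rewrite nth_cat sw ifT; last by lia.
  have -> : ((n.+1 + n).-1 - n.+1 = (size w).-1)%N by lia.
  by rewrite nth_last; case: w hb {sw ha}.
move=> i le lt; rewrite nth_cat size_nseq ifF; last by lia.
rewrite nth_cat sw ifF; last by lia.
by rewrite nth_nseq ifT //; lia.
Qed.

(* The shift s would make an initial run of z' cover either the end of the first
   run of z and the first letter of its core, or the last letter of the core and
   the beginning of the last run. *)
Lemma marker_words_no_overlap X n z z' u v u' v' :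
  marker_words X n z -> marker_words X n z' -> u ++ z ++ v = u' ++ z' ++ v' ->
  size u < size u' -> size u' < size u + (n.+1 + n) -> False.
Proof.
move=> Zz Zz' e lt1 lt2.
have sz := size_marker_words Zz; have sz' := size_marker_words Zz'.
have l0 : A by case: u' lt1 {e lt2}.
have [a [b [n0 za zna znb zb]]] := marker_words_letters l0 Zz.
have [c [_ [_ zc _ _ _]]] := marker_words_letters l0 Zz'.
pose s := (size u' - size u)%N.
have shift i : s + i < n.+1 + (n + n.+1) -> nth l0 z (s + i) = nth l0 z' i.
  move=> lt.
  have : nth l0 (u ++ z ++ v) (size u + (s + i)) =
      nth l0 (u' ++ z' ++ v') (size u' + i).
    by rewrite e; congr nth; rewrite /s; lia.
  rewrite nth_cat ifF; last by lia.
  rewrite addKn nth_cat sz lt => ->.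
  rewrite nth_cat ifF; last by lia.
  by rewrite addKn nth_cat sz' ifT //; lia.
case: (ltnP s n.+1) => ls.
  apply: zna; have -> : n.+1 = (s + (n.+1 - s))%N by lia.
  rewrite shift; last by lia.
  rewrite zc; last by rewrite /s; lia.
  by rewrite -(za s) // -[s]addn0 shift ?zc // addn0; lia.
apply: znb.
have -> : (n.+1 + n).-1 = (s + ((n.+1 + n).-1 - s))%N by rewrite /s; lia.
rewrite shift; last by rewrite /s; lia.
rewrite zc; last by lia.
rewrite -(zb (n.+1 + n)) //; last by lia.
have -> : (n.+1 + n = s + (n.+1 + n - s))%N by rewrite /s; lia.
rewrite shift; last by rewrite /s; lia.
by rewrite zc //; lia.
Qed.

(** If only words of [X] met the occurrence of [w], their product would have [w] as a factor. *)
Lemma incompletable_meets_marker X Z ys p w q : [set` ys] `<=` X `|` Z ->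
  flatten ys = p ++ w ++ q -> ~ factors (lang_star X) w ->
  exists ys1 z ys2, [/\ ys = ys1 ++ z :: ys2, Z z,
    size (flatten ys1) < size p + size w & size p < size (flatten ys1) + size z].
Proof.
move=> hys e Fw; have w0 : 0 < size w.
  rewrite lt0n size_eq0; apply/eqP => w0; apply: Fw; rewrite w0.
  by apply: self_factors; apply/starP; exists [::].
elim: ys p hys e => [|y ys IH] p.
  by move=> _ /(congr1 size) /=; rewrite !size_cat; lia.
move=> /sub_cons[Yy hys] /= e; case: (leqP (size y) (size p)) => lyp.
  have [t pt et] := cat_eq_split e lyp.
  have [ys1 [z [ys2 [-> Zz l1 l2]]]] := IH t hys et.
  by exists (y :: ys1), z, ys2; split=> //=; rewrite pt !size_cat; lia.
case: Yy => [Xy|Zy]; last by exists [::], y, ys; split=> //=; lia.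
have [t yt et] := cat_eq_split (esym e) (ltnW lyp).
case: (leqP (size w) (size t)) => lwt.
  have [t' tw _] := cat_eq_split et lwt.
  by case: Fw; apply/factorsP; exists p, t'; apply: star1; rewrite -tw -yt.
have [w2 ww et'] := cat_eq_split (esym et) (ltnW lwt).
have [hX|[ys1 [z [ys2 [eys hX Zz]]]]] := first_marker hys.
  case: Fw; apply/factorsP; exists p, q; rewrite ww -!catA -et' catA -yt.
  by apply: star_cat; [exact: star1|exact: flatten_star].
case: (ltnP (size (flatten ys1)) (size w2)) => l1.
  exists (y :: ys1), z, ys2; split=> //=; rewrite ?eys //.
    by rewrite ww yt !size_cat; lia.
  by rewrite size_cat; lia.
move: et'; rewrite eys flatten_cat /= => /esym et'.
have [r er _] := cat_eq_split et' l1.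
case: Fw; apply/factorsP; exists p, r; rewrite ww -!catA -er catA -yt.
by apply: star_cat; [exact: star1|exact: flatten_star].
Qed.

(** The core of [z] must meet a marker factor of the product. The starting positions of the two then
    differ by less than [n.+1 + n], and the absence of such overlaps makes them equal. *)
Lemma marker_words_markers X n : markers X (marker_words X n) (n.+1 + (n + n.+1)).
Proof.
split=> //; first exact: size_marker_words.
  move=> z [a [b [w [sw Fw _ _ ->]]]] Fz; apply: Fw; exact: factors_sub Fz.
move=> ys u z v hys Zz e; have := Zz => -[a [b [w [sw Fw _ _ ez]]]].
have ew : flatten ys = (u ++ nseq n.+1 a) ++ w ++ (nseq n.+1 b ++ v).
  by rewrite e ez -!catA.
have [ys1 [z' [ys2 [eys Zz' l1 l2]]]] := incompletable_meets_marker hys ew Fw.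
move: l1 l2; rewrite (size_marker_words Zz') !size_cat size_nseq sw => l1 l2.
move: e; rewrite eys flatten_cat /= => e.
case: (ltngtP (size (flatten ys1)) (size u)) => [lt|lt|es].
- by case: (marker_words_no_overlap Zz' Zz e lt); lia.
- by case: (marker_words_no_overlap Zz Zz' (esym e) lt); lia.
move/eqP: e; rewrite eqseq_cat // => /andP[/eqP eu].
rewrite eqseq_cat ?(size_marker_words Zz) ?(size_marker_words Zz') //.
by move=> /andP[/eqP <- _]; exists ys1, ys2.
Qed.

(** Serves the empty code, since over a one-letter alphabet there are no marker words. *)
Lemma letters_markers : markers (set0 : set word) [set z | size z = 1] 1.
Proof.
split=> //.
  move=> z sz /factorsP[u [v /starP[[|x xs] h e]]].
    by move: e sz => /(congr1 size); rewrite !size_cat /=; lia.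
  by case/sub_cons: h.
move=> ys u z v; rewrite set0U => hys sz; elim: ys u hys => [|y ys IH] u.
  by move=> _ /(congr1 size); rewrite !size_cat /= sz; lia.
move=> /sub_cons[/= sy hys] /= e.
case: u e => [|a u] /= e.
  move/eqP: e; rewrite eqseq_cat ?sy ?sz // => /andP[/eqP-> _].
  by exists [::], ys.
have [|t et e'] := cat_eq_split (u := y) (v := flatten ys) (p := a :: u) e; first by rewrite sy.
have [ys1 [ys2 [-> e1]]] := IH t hys e'.
by exists (y :: ys1), ys2; rewrite /= e1 et.
Qed.

(** * Families of codes *)

(** If [X] contained the empty word, every word of [X] would extend it and so be empty; that leaves
    only the excluded set. *)
Lemma prefix_codeP X : prefix_code X <->
  ~ X [::] /\ forall x t, X x -> X (x ++ t) -> t = [::].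
Proof.
split=> [[X1 X0]|[noe inc]].
  have inc x t : X x -> X (x ++ t) -> t = [::].
    move=> Xx Xxt; apply: contrapT => t0.
    suff : (X `&` lang_cat X (@nonempty_words A)) (x ++ t) by rewrite X0.
    by split=> //; exists x => //; exists t.
  split=> // Xnil; apply: X1; apply/seteqP; split=> [w Xw|w ->//].
  exact: (inc [::] w).
split=> [X1|]; first by apply: noe; rewrite X1.
apply/seteqP; split=> // w [Xw [x Xx [t t0 e]]]; apply: t0.
by apply: (inc x) => //; rewrite e.
Qed.

Lemma suffix_codeP X : suffix_code X <-> prefix_code (reversal X).
Proof.
rewrite prefix_codeP; split=> [[X1 X0]|[noe inc]].
  have inc x t : X x -> X (t ++ x) -> t = [::].
    move=> Xx Xtx; apply: contrapT => t0.
    suff : (X `&` lang_cat (@nonempty_words A) X) (t ++ x) by rewrite X0.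
    by split=> //; exists t => //; exists x.
  split=> [Xnil|x t Xx]; last first.
    by rewrite /reversal /= rev_cat => /(inc _ _ Xx)/(congr1 rev); rewrite revK.
  apply: X1; apply/seteqP; split=> [w Xw|w ->//].
  by apply: (inc [::] w) => //; rewrite cats0.
split=> [X1|]; first by apply: noe; rewrite /reversal /= X1.
apply/seteqP; split=> // w [Xw [t t0 [x Xx e]]]; apply: (rev_neq0 t0).
by apply: (inc (rev x)); rewrite /reversal /= ?rev_cat !revK // e.
Qed.

Lemma prefix_code_code X : prefix_code X -> code X.
Proof.
move=> /prefix_codeP[noe inc]; elim=> [|x xs IH] [|y ys] //=.
- by move=> _ /sub_cons[Xy _]; case: y Xy => [/noe|].
- by move=> /sub_cons[Xx _]; case: x Xx => [/noe|].
move=> /sub_cons[Xx hx] /sub_cons[Xy hy] e.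
have exy : x = y.
  case: (leqP (size x) (size y)) => le.
    have [t et _] := cat_eq_split e le.
    by move: Xy; rewrite et => /(inc _ _ Xx) ->; rewrite cats0.
  have [t et _] := cat_eq_split (esym e) (ltnW le).
  by move: Xx; rewrite et => /(inc _ _ Xy) ->; rewrite cats0.
move/eqP: e; rewrite exy eqseq_cat // eqxx /= => /eqP e.
by rewrite (IH ys).
Qed.

Lemma family_code (f : code_family) X : family_codes f X -> code X.
Proof.
case: f => /=; [exact: prefix_code_code|by case=> /prefix_code_code|..];
  by case=> // -[].
Qed.

(** A marker may begin or end with a word of [X], which is why prefix and bifix codes are extended
    differently. *)
Lemma markers_family (f : code_family) X Z L : markers X Z L ->
  f <> PrefixCodes -> f <> BifixCodes -> family_codes f X -> family_codes f (X `|` Z).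
Proof.
move=> mZ f1 f2; have fdd Y T : markers Y T L -> fdd_code Y -> fdd_code (Y `|` T).
  move=> mT [cY [d /bounded_delayP dY]]; split; first exact: markers_code mT cY.
  by exists (d + L)%N; apply/bounded_delayP; exact: markers_bounded_delay.
case: f f1 f2 => //= _ _.
- exact: fdd.
- move=> [fX [d /right_bounded_delayP dX]]; split; first exact: fdd.
  have [cX _] := fX.
  exists (d + L)%N; apply/right_bounded_delayP; rewrite reversalU.
  apply: markers_bounded_delay => //; [exact: markers_reversal|exact: code_reversal].
- move=> /uniformly_synchronizedP[cX [k k0 [s1 s2]]]; apply/uniformly_synchronizedP.
  split; first exact: markers_code mZ cX.
  exists (k + L.+1)%N; first by rewrite addnS.
  split; first exact: markers_right_synchronized.
  rewrite reversalU; apply: markers_right_synchronized => //.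
    exact: markers_reversal.
  exact: code_reversal.
- exact: (markers_circular mZ).
Qed.

(** * Extending an incomplete prefix code *)

Definition prefix_incomparable X n : set word := [set w | size w = n /\
  forall x, X x -> ~ prefix x w /\ ~ prefix w x].

(** Distinct words of equal length are incomparable. Allowing any subset [Z] covers the bifix
    extension as well. *)
Lemma prefix_code_extension X Z n : 0 < n -> Z `<=` prefix_incomparable X n ->
  prefix_code X -> prefix_code (X `|` Z).
Proof.
move=> n0 ZX /prefix_codeP[noe inc]; apply/prefix_codeP; split.
  by move=> [//|/ZX[/= sz _]]; move: n0; rewrite -sz.
move=> x t [Xx|/ZX[sx hx]] [Xxt|/ZX[sxt hxt]].
- exact: inc Xxt.
- by case: (hxt x Xx) => -[]; exact: prefix_prefix.
- by case: (hx _ Xxt) => _ []; exact: prefix_prefix.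
- by apply: size0nil; move: sxt sx; rewrite size_cat /=; lia.
Qed.

(* Strip from w the words of X as long as it starts with one. *)
Lemma prefix_incomparable_exists X w : code X -> (forall v, ~ lang_star X (w ++ v)) ->
  exists n w', 0 < n /\ prefix_incomparable X n w'.
Proof.
move=> cX; have [m] := ubnP (size w); elim: m w => // m IH w lt hw.
case: (pselect (exists2 x, X x & prefix x w)) => [[x Xx /prefixP[t ew]]|nX].
  apply: (IH t) => [|v hv].
    move: lt; rewrite ew size_cat; case: x Xx {ew} => [/(code_nonempty cX)//|a x _] /=.
    by lia.
  by apply: (hw v); rewrite ew -catA; apply: star_cat => //; exact: star1.
exists (size w), w; split.
  rewrite lt0n size_eq0; apply/eqP => w0; apply: (hw [::]).
  by rewrite w0; apply/starP; exists [::].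
split=> // x Xx; split=> [xw|/prefixP[t et]]; first by apply: nX; exists x.
by apply: (hw t); rewrite -et; exact: star1.
Qed.

Lemma prefix_incomparable_cat X n m w v : prefix_incomparable X n w -> size v = m ->
  prefix_incomparable X (n + m) (w ++ v).
Proof.
move=> [sw h] sv; split=> [|x Xx]; first by rewrite size_cat sw sv.
have [h1 h2] := h x Xx; split=> /prefixP[t e].
  case: (leqP (size x) (size w)) => le.
    by have [t' ew _] := cat_eq_split (esym e) le; apply: h1; rewrite ew prefix_prefix.
  have [t' ex _] := cat_eq_split e (ltnW le).
  by apply: h2; rewrite ex prefix_prefix.
by apply: h2; rewrite e -catA prefix_prefix.
Qed.

Definition bifix_incomparable X n : set word :=
  prefix_incomparable X n `&` reversal (prefix_incomparable (reversal X) n).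

Lemma prefix_incomparable_notin X n w : prefix_incomparable X n w -> ~ X w.
Proof. by move=> [_ h] Xw; have [] := h w Xw; rewrite prefix_refl. Qed.

Lemma bifix_incomparable_exists X w : code X -> ~ factors (lang_star X) w ->
  exists n w', 0 < n /\ bifix_incomparable X n w'.
Proof.
move=> cX Fw; have [v|n [p [n0 hp]]] := prefix_incomparable_exists (w := w) cX.
  by move=> hv; apply: Fw; apply/factorsP; exists [::], v.
have [v|m [q [_ hq]]] := prefix_incomparable_exists (w := rev w) (code_reversal cX).
  move=> /star_reversal; rewrite rev_cat revK => hv.
  by apply: Fw; apply/factorsP; exists (rev v), [::]; rewrite cats0.
(* Incomparability survives lengthening at the far end, so [p] secures the prefix side and [rev q]
   the suffix side. *)
exists (n + m)%N, (p ++ rev q); split; first by rewrite addn_gt0 n0.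
split; first by apply: prefix_incomparable_cat => //; rewrite size_rev; case: hq.
rewrite /reversal /= rev_cat revK addnC.
by apply: prefix_incomparable_cat => //; rewrite size_rev; case: hp.
Qed.

Lemma bifix_code_extension X n : 0 < n -> bifix_code X ->
  bifix_code (X `|` bifix_incomparable X n).
Proof.
move=> n0 [pX /suffix_codeP sX]; split.
  by apply: prefix_code_extension n0 _ pX => w [].
apply/suffix_codeP; rewrite reversalU; apply: prefix_code_extension n0 _ sX.
by move=> w [_]; rewrite /reversal /= revK.
Qed.

(** * Literal morphisms and antimorphisms *)

(* The literal (anti)morphism with letter map g; r tells whether it reverses words. *)
Definition relabel (r : bool) (g : A -> A) w := if r then rev (map g w) else map g w.

Lemma relabelK r g h : cancel g h -> cancel (relabel r g) (relabel r h).
Proof. by move=> gK w; case: r; rewrite /= ?map_rev ?revK (mapK gK). Qed.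

Lemma size_relabel r g w : size (relabel r g w) = size w.
Proof. by case: r; rewrite /= ?size_rev size_map. Qed.

Lemma relabel_star X r g w : (forall x, X x -> X (relabel r g x)) ->
  lang_star X w -> lang_star X (relabel r g w).
Proof.
move=> h /starP[xs hxs ->]; elim: xs hxs => [|x xs IH].
  by move=> _; case: r h => _; apply/starP; exists [::].
move=> /sub_cons[/h/star1 Xx /IH {}IH]; case: r h Xx IH => _ Xx IH /=.
  by rewrite map_cat rev_cat; exact: star_cat.
by rewrite map_cat; exact: star_cat.
Qed.

Lemma relabel_factors X r g w : (forall x, X x -> X (relabel r g x)) ->
  factors (lang_star X) w -> factors (lang_star X) (relabel r g w).
Proof.
move=> h /factorsP[u [v /(relabel_star h) huv]]; apply/factorsP.
case: r h huv => _; rewrite /= !map_cat ?rev_cat -?catA => huv.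
  by exists (rev (map g v)), (rev (map g u)).
by exists (map g u), (map g v).
Qed.

(** [theta] preserves length, so the preimage of a letter is a letter: the letter map is onto, and
    it is injective because [theta] is. *)
Lemma literal_relabel (theta : word -> word) : bijective theta -> literal theta ->
  word_morphism theta \/ word_antimorphism theta ->
  exists r g h, [/\ cancel g h, cancel h g & theta =1 relabel r g].
Proof.
move=> [theta' thetaK theta'K] /choice[g gE] morph.
have [r rE] : exists r, theta =1 relabel r g.
  case: morph => -[t0 tM]; [exists false|exists true]; elim=> //= a w IH.
    by rewrite -cat1s tM IH gE.
  by rewrite -cat1s tM IH gE rev_cons cats1.
have /choice[h hK] : forall b, exists a, g a = b.
  move=> b; have : size (theta' [:: b]) = 1.
    by rewrite -(size_relabel r g) -rE theta'K.
  case e : (theta' [:: b]) => [|a [|]] // _; exists a.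
  by have := gE a; rewrite -e theta'K => -[].
exists r, g, h; split=> // a; suff : [:: h (g a)] = [:: a] by case.
by apply: (can_inj thetaK); rewrite !gE hK.
Qed.

Section Relabel.
Variables (X : set word) (r : bool) (g h : A -> A).
Hypotheses (gK : cancel g h) (hK : cancel h g).
Hypothesis (hX : forall x, X x -> X (relabel r h x)).

Lemma relabel_marker_words n z : marker_words X n z -> marker_words X n (relabel r g z).
Proof.
move=> [a [b [w [sw Fw ha hb ->]]]].
(* A negative condition is pulled back along the inverse relabelling, hence the hypothesis on
   [h]. *)
have Fgw : ~ factors (lang_star X) (relabel r g w).
  by move=> /(relabel_factors hX); rewrite relabelK.
have sgw : size (relabel r g w) = n by rewrite size_relabel.
have {}ha : head (g a) (map g w) <> g a.
  move=> e; apply: ha; case: w e {sw Fw hb Fgw sgw} => //= c w.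
  exact: (can_inj gK).
have {}hb : last (g b) (map g w) <> g b by rewrite last_map => /(can_inj gK).
rewrite /relabel !map_cat !map_nseq; case: r Fgw sgw => Fgw sgw; last first.
  by exists (g a), (g b), (map g w); split.
(* Reversal exchanges the two runs. *)
exists (g b), (g a), (rev (map g w)); split=> //.
- by move: hb; case/lastP: (map g w) => // s c; rewrite last_rcons rev_rcons.
- by move: ha; case: (map g w) => // c s; rewrite rev_cons last_rcons.
- by rewrite !rev_cat !rev_nseq catA.
Qed.

Lemma map_prefix_incomparable Y Y' n w : (forall x, Y' x -> Y (map h x)) ->
  prefix_incomparable Y n w -> prefix_incomparable Y' n (map g w).
Proof.
move=> YY' [sw hw]; split=> [|x /YY' Yx]; first by rewrite size_map.
have [h1 h2] := hw _ Yx; split=> /prefixP[t e].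
  apply: h1; apply/prefixP; exists (map h t).
  by rewrite -map_cat -e (mapK gK).
by apply: h2; rewrite e map_cat (mapK gK) prefix_prefix.
Qed.

Lemma relabel_bifix_incomparable n w :
  bifix_incomparable X n w -> bifix_incomparable X n (relabel r g w).
Proof.
move=> [h1 h2]; case: r hX => /= hX'; split.
- by rewrite -map_rev; apply: map_prefix_incomparable h2 => x /hX'.
- rewrite /reversal /= revK; apply: map_prefix_incomparable h1 => x /hX'.
  by rewrite map_rev revK.
- exact: map_prefix_incomparable h1.
- rewrite /reversal /= -map_rev; apply: map_prefix_incomparable h2 => x /hX'.
  by rewrite /reversal /= map_rev.
Qed.

End Relabel.

(** * Invariant extension inside each family *)

Lemma marker_words_exist X w : code X -> X !=set0 -> ~ factors (lang_star X) w ->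
  exists z, marker_words X (size w) z.
Proof.
move=> cX [x Xx] Fw.
(* Were [c] the only letter, [w] would be a power of [c], hence a factor of a large enough power of
   the nonempty word [x]. *)
have other (c : A) : exists a, a <> c.
  apply: contrapT => /forallNP all_c.
  have unary (s : word) : s = nseq (size s) c.
    by apply/all_pred1P/allP => a _; apply/eqP; apply: contrapT; exact: all_c.
  pose xs := nseq (size w) x; have hxs : [set` xs] `<=` X by exact: sub_nseq.
  have le : size w <= size (flatten xs).
    by apply: (leq_size_flatten cX hxs); rewrite size_nseq.
  apply: Fw; apply/factorsP; exists [::], (nseq (size (flatten xs) - size w) c) => /=.
  by rewrite [w in w ++ _]unary -nseqD subnKC // -unary; exact: flatten_star.
case: w Fw => [|c w] Fw.
  by case: Fw; apply: self_factors; apply/starP; exists [::].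
have [a ac] := other c; have [b bl] := other (last c w).
exists (nseq (size (c :: w)).+1 a ++ (c :: w) ++ nseq (size (c :: w)).+1 b), a, b, (c :: w).
by split=> //= e; [apply: ac|apply: bl].
Qed.

Lemma family_extension (f : code_family) X r g h : cancel g h -> cancel h g ->
  (forall x, X x -> X (relabel r g x)) -> (forall x, X x -> X (relabel r h x)) ->
  family_codes f X -> ~ complete X ->
  exists Z, [/\ exists2 z, Z z & ~ X z, family_codes f (X `|` Z),
    forall z, Z z -> Z (relabel r g z) & forall z, Z z -> Z (relabel r h z)].
Proof.
move=> gK hK hg hh fX /not_setT_ex[w Fw]; have cX := family_code fX.
have bifix : bifix_code X -> exists Z, [/\ exists2 z, Z z & ~ X z, bifix_code (X `|` Z),
    forall z, Z z -> Z (relabel r g z) & forall z, Z z -> Z (relabel r h z)].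
  move=> bX; have [n [z [n0 hz]]] := bifix_incomparable_exists cX Fw.
  exists (bifix_incomparable X n); split.
  - by exists z => //; case: hz => /prefix_incomparable_notin.
  - exact: bifix_code_extension.
  - by move=> y; exact: relabel_bifix_incomparable.
  - by move=> y; exact: relabel_bifix_incomparable.
case: (pselect (f = BifixCodes)) => [f_bifix|f_bifix].
  by rewrite f_bifix in fX *; exact: bifix.
case: (pselect (f = PrefixCodes)) => [f_prefix|f_prefix].
  rewrite f_prefix /= in fX *; case: r hg hh bifix => hg hh bifix.
    (* A prefix code stable under a reversing relabelling is also a suffix code, so the bifix
       extension applies. *)
    have [|Z [hZ [pXZ _] Zg Zh]] := bifix; last by exists Z.
    split=> //; apply/suffix_codeP/prefix_codeP.
    move/prefix_codeP: fX => [noe inc]; split=> // x t Xx Xxt.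
    have {}Xx : X (map g x) by rewrite -[map g x]revK -map_rev; exact: hg Xx.
    have {}Xxt : X (map g x ++ map g t).
      by rewrite -map_cat -[map g _]revK -map_rev; exact: hg Xxt.
    by apply: size0nil; rewrite -(size_map g) (inc _ _ Xx Xxt).
  have [v|n [z [n0 hz]]] := prefix_incomparable_exists (w := w) cX.
    by move=> hv; apply: Fw; apply/factorsP; exists [::], v.
  exists (prefix_incomparable X n); split.
  - by exists z => //; exact: prefix_incomparable_notin hz.
  - exact: prefix_code_extension n0 _ fX.
  - by move=> y; exact: map_prefix_incomparable.
  - by move=> y; exact: map_prefix_incomparable.
case: (pselect (X !=set0)) => [X0|/set0P/negP/negPn/eqP X0].
  have [z Zz] := marker_words_exist cX X0 Fw.
  have mZ := marker_words_markers X (size w).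
  exists (marker_words X (size w)); split.
  - by exists z => //; exact: markers_notin mZ Zz.
  - exact: (markers_family mZ).
  - by move=> y; exact: (relabel_marker_words gK hh).
  - by move=> y; exact: (relabel_marker_words hK hg).
rewrite X0 in fX Fw *; exists [set z | size z = 1]; split.
- case: w Fw => [|a w _]; last by exists [:: a].
  by case; apply: self_factors; apply/starP; exists [::].
- exact: (markers_family letters_markers).
- by move=> y /=; rewrite size_relabel.
- by move=> y /=; rewrite size_relabel.
Qed.

(** An incomplete [X] has a proper extension in the family; stability of the added words under the
    relabelling and its inverse makes that extension [theta]-invariant. *)
Lemma invariant_extension_complete (theta : word -> word) (f : code_family) X :
  bijective theta -> literal theta -> word_morphism theta \/ word_antimorphism theta ->
  maximal_in (code `&` invariant_under theta `&` family_codes f) X -> complete X.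
Proof.
move=> theta_bij theta_lit theta_morph [[[cX iX] fX] maxX]; apply: contrapT => ncX.
have [r [g [h [gK hK thetaE]]]] := literal_relabel theta_bij theta_lit theta_morph.
have thetaK : cancel (relabel r h) theta by move=> w; rewrite thetaE (relabelK r hK).
have hg x : X x -> X (relabel r g x) by move=> Xx; rewrite -iX -thetaE; exists x.
have hh x : X x -> X (relabel r h x).
  by rewrite -{1}iX => -[y Xy <-]; rewrite thetaE relabelK.
have [Z [[z Zz Xz] fXZ Zg Zh]] := family_extension gK hK hg hh fX ncX.
apply: (maxX (X `|` Z)); last first.
  by split; [exact: subsetUl|move=> /(_ z) XZz; apply: Xz; apply: XZz; right].
split=> //; split; first exact: family_code fXZ.
apply/seteqP; split=> [_ [y Yy <-]|y Yy].
  by rewrite thetaE; case: Yy => [/hg|/Zg]; [left|right].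
exists (relabel r h y); last exact: thetaK.
by case: Yy => [/hh|/Zh]; [left|right].
Qed.

End Words.

(** * The cycle of implications *)

Theorem theorem4 (A : countType) (theta : seq A -> seq A)
    (theta_bij : bijective theta) (theta_literal : literal theta)
    (theta_morph : word_morphism theta \/ word_antimorphism theta)
    (f : code_family) (X : set (seq A))
    (X_thin : thin X) (X_inv : invariant_under theta X)
    (X_code : code X) (X_family : family_codes f X) :
  [<-> complete X;
       maximal_in code X;
       maximal_in (family_codes f) X;
       maximal_in (code `&` invariant_under theta) X;
       maximal_in (code `&` invariant_under theta `&` family_codes f) X].
Proof.
have v_i := @invariant_extension_complete A theta f X theta_bij theta_literal theta_morph.
have i_ii := complete_maximal X_thin X_code.
tfae=> //.
- by move=> [_ maxX]; split=> // Y fY; apply: maxX; exact: family_code fY.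
(* Maximality in the family passes to its invariant members, which gives completeness and then
   maximality among all codes; the latter restricts to invariant codes. *)
- move=> [_ maxX]; have [] : maximal_in code X.
    by apply/i_ii/v_i; split=> // Y [_ fY]; exact: maxX.
  by move=> _ max_code; split=> // Y [cY _]; exact: max_code.
- by move=> [_ maxX]; split=> // Y [cY _]; exact: maxX.
Qed.
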